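(* Let $E$ and $F$ be Banach lattices such that $E^\ast$ and $F$ both have order continuous norms, every order interval of $F$ is a limited set, and each disjoint bounded sequence of $E$ is order bounded. Then each regular operator $T:E\to F$ is almost limited.
   Context: All vector spaces are real and all operators are linear. $B_E$ is the closed unit ball of $E$. A bounded subset $C$ of a Banach space $X$ is limited if every $\mathrm{w}^\ast$-null sequence in $X^\ast$ converges to zero uniformly on $C$. A bounded subset $A$ of a Banach lattice $F$ is almost limited if every disjoint $\mathrm{w}^\ast$-null sequence in $F^\ast$ converges to zero uniformly on $A$; a bounded operator $T:E\to F$ is almost limited if $T(B_E)$ is almost limited in $F$. An operator is regular if it is a difference of two positive operators. ''Bounded'' for sequences means norm bounded. *)

(* Defs.v *)
From HB Require Import structures.
From mathcomp Require Import all_boot all_order all_algebra.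
From mathcomp Require Import all_classical all_reals all_analysis.
From mathcomp Require Import ring lra.

Set Implicit Arguments.
Unset Strict Implicit.
Unset Printing Implicit Defensive.

Import Order.TTheory GRing.Theory Num.Theory.
Import numFieldNormedType.Exports.

Local Open Scope classical_set_scope.
Local Open Scope ring_scope.

(* The order is given by fields of the mixin rather than by Order.Lattice: HB
   refuses a join of normedModType R with the order structures of MathComp that
   is not an ancestor of Num.NumDomain. *)
HB.mixin Record isBanachLattice (R : realType) E of CompleteNormedModule R E := {
  vle : E -> E -> Prop ;
  vsup : E -> E -> E ;
  vinf : E -> E -> E ;
  vle_refl : forall x, vle x x ;
  vle_anti : forall x y, vle x y -> vle y x -> x = y ;
  vle_trans : forall y x z, vle x y -> vle y z -> vle x z ;
  vle_supP : forall x y z, vle (vsup x y) z <-> vle x z /\ vle y z ;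
  vle_infP : forall x y z, vle z (vinf x y) <-> vle z x /\ vle z y ;
  vleD2l : forall z x y, vle x y -> vle (z + x) (z + y) ;
  vleZ2l : forall (a : R) x y, 0 <= a -> vle x y -> vle (a *: x) (a *: y) ;
  vle_norm : forall x y, vle (vsup x (- x)) (vsup y (- y)) -> `|x| <= `|y|
}.

#[short(type="banachLatticeType")]
HB.structure Definition BanachLattice (R : realType) :=
  {E of CompleteNormedModule R E & isBanachLattice R E}.

Arguments vle_anti {R s} [x y].
Arguments vle_trans {R s} y [x z].
Arguments vleD2l {R s} z [x y].
Arguments vleZ2l {R s} [a x y].
Arguments vle_norm {R s} [x y].

Declare Scope lattice_scope.
Delimit Scope lattice_scope with L.
Local Open Scope lattice_scope.

Notation "x <=v y" := (vle x y) (at level 70, y at next level) : lattice_scope.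

Definition vabs {R : realType} {E : banachLatticeType R} (x : E) : E :=
  vsup x (- x).

Section dual_space.
Context {R : realType} {E : normedModType R}.

Definition functional_pred : {pred E -> R} :=
  mem [set f : E -> R | linear f /\ continuous f].

Lemma functional_submod_closed : submod_closed functional_pred.
Proof.
split=> [|a f g].
  rewrite inE/=; split; last exact: cst_continuous.
  by move=> k x y /=; rewrite scaler0 addr0.
rewrite !inE/= => -[lf cf] [lg cg]; split.
  move=> k x y; rewrite !fctE lf lg !scalerDr !scalerA (mulrC k a).
  by rewrite addrACA.
by move=> x; apply: cvgD; [apply: cvgZr; exact: cf|exact: cg].
Qed.

HB.instance Definition _ := GRing.isSubmodClosed.Build R (E -> R)
  functional_pred functional_submod_closed.

Record dual_space := Functional {
  functional_fun :> E -> R ;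
  functional_prop : functional_fun \in functional_pred }.

HB.instance Definition _ := [isSub for functional_fun].
HB.instance Definition _ := [Choice of dual_space by <:].
HB.instance Definition _ := [SubChoice_isSubLmodule of dual_space by <:].

Lemma functional_linear (f : dual_space) : linear f.
Proof. by case: f => f /=; rewrite inE => -[]. Qed.

Lemma functional_continuous (f : dual_space) : continuous f.
Proof. by case: f => f /=; rewrite inE => -[]. Qed.

HB.instance Definition _ (f : dual_space) :=
  GRing.isLinear.Build R E R *:%R f (functional_linear f).

Definition dual_norm (f : dual_space) : R :=
  sup [set `|f x| | x in [set x : E | `|x| <= 1]].

Lemma functional_bounded (f : dual_space) :
  exists M : R, forall x, `|f x| <= M * `|x|.
Proof.
have /linear_boundedP/pinfty_ex_gt0[M _ fM] :=
  @continuous_linear_bounded R E R 0 f (@functional_continuous f 0).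
by exists M.
Qed.

Lemma dual_norm_has_sup (f : dual_space) :
  has_sup [set `|f x| | x in [set x : E | `|x| <= 1]].
Proof.
split; first by exists `|f 0|, 0 => //=; rewrite normr0.
have [M fM] := functional_bounded f; exists `|M| => _ [x /= x1 <-].
rewrite (le_trans (fM x))// (le_trans (ler_wpM2r _ (ler_norm M)))//.
by rewrite ler_piMr.
Qed.

Lemma dual_norm_ub (f : dual_space) x : `|f x| <= dual_norm f * `|x|.
Proof.
have [->|x0] := eqVneq x 0; first by rewrite linear0 !normr0 mulr0.
have nx0 : 0 < `|x| by rewrite normr_gt0.
rewrite -ler_pdivrMr//.
apply: (sup_upper_bound (dual_norm_has_sup f)).
exists (`|x|^-1 *: x) => /=.
  by rewrite normrZ normfV normr_id mulVf ?gt_eqF.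
by rewrite linearZ/= normrM normfV normr_id mulrC.
Qed.

Lemma dual_norm_le (f : dual_space) (M : R) :
  (forall x, `|x| <= 1 -> `|f x| <= M) -> dual_norm f <= M.
Proof.
move=> fM; apply: ge_sup; first by have [] := dual_norm_has_sup f.
by move=> _ [x /= x1 <-]; exact: fM.
Qed.

Lemma dual_norm_ge0 (f : dual_space) : 0 <= dual_norm f.
Proof.
apply: (le_trans (normr_ge0 (f 0))).
apply: (sup_upper_bound (dual_norm_has_sup f)).
by exists 0 => //=; rewrite normr0.
Qed.

Lemma dual_normD (f g : dual_space) :
  dual_norm (f + g) <= dual_norm f + dual_norm g.
Proof.
apply: dual_norm_le => x x1; rewrite (le_trans (ler_normD _ _))// lerD//.
  by rewrite (le_trans (dual_norm_ub _ _))// ler_piMr// dual_norm_ge0.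
by rewrite (le_trans (dual_norm_ub _ _))// ler_piMr// dual_norm_ge0.
Qed.

Lemma dual_normZ_le (a : R) (f : dual_space) :
  dual_norm (a *: f) <= `|a| * dual_norm f.
Proof.
apply: dual_norm_le => x x1; rewrite normrM ler_wpM2l//.
by rewrite (le_trans (dual_norm_ub _ _))// ler_piMr// dual_norm_ge0.
Qed.

Lemma dual_normZ (a : R) (f : dual_space) :
  dual_norm (a *: f) = `|a| * dual_norm f.
Proof.
apply/eqP; rewrite eq_le dual_normZ_le/=.
have [->|a0] := eqVneq a 0; first by rewrite normr0 mul0r dual_norm_ge0.
rewrite -ler_pdivlMl ?normr_gt0// -normfV.
by rewrite -{1}[f](scalerK a0) dual_normZ_le.
Qed.

Lemma dual_norm_eq0 (f : dual_space) : dual_norm f = 0 -> f = 0.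
Proof.
move=> f0; apply/val_inj/funext => x /=; apply/eqP.
by rewrite -normr_le0 (le_trans (dual_norm_ub _ _))// f0 mul0r.
Qed.

HB.instance Definition _ := Lmodule_isNormed.Build R dual_space
  dual_normD dual_normZ dual_norm_eq0.

Lemma dual_normE (f : dual_space) :
  `|f| = sup [set `|f x| | x in [set x : E | `|x| <= 1]].
Proof. by []. Qed.

End dual_space.
Arguments dual_space {R} E.


Section dual_complete.
Context {R : realType} {E : normedModType R}.
Implicit Types f : dual_space E.

Lemma dual_complete (F : set_system (dual_space E)) :
  ProperFilter F -> cauchy F -> cvg F.
Proof.
move=> FF /cauchyP Fc.
have Fx x : cvg ((fun f => f x) @ F).
  apply: cauchy_cvg; apply/cauchyP => e e0.
  have d0 : 0 < e / (`|x| + 1) by rewrite divr_gt0 ?ltr_wpDl.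
  have [f Ff] := Fc _ d0; exists (f x); rewrite nbhs_simpl/=.
  apply: filterS Ff => g; rewrite -!ball_normE/= => fg.
  rewrite (le_lt_trans (dual_norm_ub (f - g) x))//.
  rewrite (@le_lt_trans _ _ (dual_norm (f - g) * (`|x| + 1)))//.
    by rewrite ler_wpM2l ?dual_norm_ge0// lerDl.
  by rewrite -ltr_pdivlMr ?ltr_wpDl.
pose g x := lim ((fun f => f x) @ F).
have gl : linear g.
  move=> a x y; apply: cvg_lim => //=.
  under eq_fun do rewrite linearP.
  by apply: cvgD; [apply: cvgZr; exact: Fx|exact: Fx].
pose G : {linear E -> R} := HB.pack g (GRing.isLinear.Build _ _ _ _ g gl).
have near_g f e : F (ball f e) -> forall x, `|f x - g x| <= e * `|x|.
  move=> Ff x.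
  have cv : (fun h : dual_space E => `|f x - h x|) @ F --> `|f x - g x|.
    by apply: cvg_norm; apply: cvgB; [exact: cvg_cst|exact: Fx].
  apply: (cvgr_to_le cv); apply: filterS Ff => h.
  rewrite -ball_normE/= => /ltW fh.
  by rewrite (le_trans (dual_norm_ub (f - h) x))// ler_wpM2r.
have gc : continuous g.
  have [f Ff] := Fc _ ltr01; have [M fM] := functional_bounded f.
  apply: (@bounded_linear_continuous _ _ _ G); apply/linear_boundedP.
  near=> r => x /=; rewrite -[g x](subKr (f x)).
  rewrite (le_trans (ler_normB _ _))//.
  rewrite (le_trans (lerD (fM x) (near_g _ _ Ff x)))//.
  by rewrite -mulrDl ler_wpM2r.
have gP : g \in @functional_pred R E by rewrite inE.
apply/cvg_ex; exists (Functional gP); apply/cvgrPdist_le => e e0.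
have e20 : 0 < e / 2 by rewrite divr_gt0.
have [f Ff] := Fc _ e20; apply: filterS (Ff) => h fh.
apply: dual_norm_le => x x1.
rewrite -[_ x]/(g x - h x) -(subrKA (f x)).
rewrite (le_trans (ler_normD _ _))// [leRHS](splitr e) lerD//.
  rewrite distrC (le_trans (near_g _ _ Ff x))// ler_piMr//; exact: ltW.
rewrite (le_trans (dual_norm_ub (f - h) x))//.
move: fh; rewrite -ball_normE/= => /ltW fh.
by rewrite (le_trans _ fh)// ler_piMr// dual_norm_ge0.
Unshelve. all: by end_near. Qed.

HB.instance Definition _ := Uniform_isComplete.Build (dual_space E)
  dual_complete.

End dual_complete.

Section vector_lattice.
Context {R : realType} {E : banachLatticeType R}.
Implicit Types x y z : E.

Lemma vle_supl x y : x <=v vsup x y.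
Proof. by have /vle_supP[] := vle_refl (vsup x y). Qed.

Lemma vle_supr x y : y <=v vsup x y.
Proof. by have /vle_supP[] := vle_refl (vsup x y). Qed.

Lemma vle_infl x y : vinf x y <=v x.
Proof. by have /vle_infP[] := vle_refl (vinf x y). Qed.

Lemma vle_infr x y : vinf x y <=v y.
Proof. by have /vle_infP[] := vle_refl (vinf x y). Qed.

Lemma vsubr_ge0 x y : x <=v y -> 0 <=v y - x.
Proof. by move=> /(vleD2l (- x)); rewrite addNr addrC. Qed.

Lemma vle_subr x y : 0 <=v y - x -> x <=v y.
Proof. by move=> /(vleD2l x); rewrite addr0 subrKC. Qed.

Lemma vleD x y z t : x <=v y -> z <=v t -> x + z <=v y + t.
Proof.
move=> xy zt; apply: (vle_trans (x + t)); first exact: vleD2l.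
by rewrite ![_ + t]addrC; exact: vleD2l.
Qed.

Lemma vleN2 x y : x <=v y -> - y <=v - x.
Proof. by move=> /vsubr_ge0 xy; apply: vle_subr; rewrite opprK addrC. Qed.

Lemma vle_half x : 0 <=v x + x -> 0 <=v x.
Proof.
have h0 : 0 <= 2^-1 :> R by rewrite invr_ge0.
move=> /(vleZ2l h0).
by rewrite scaler0 scalerDr -scalerDl -div1r -splitr scale1r.
Qed.

Lemma vabs_ge0 x : 0 <=v vabs x.
Proof.
by apply: vle_half; rewrite -(subrr x); apply: vleD;
  [exact: vle_supl|exact: vle_supr].
Qed.

Lemma vabs_id x : 0 <=v x -> vabs x = x.
Proof.
move=> x0; apply: vle_anti; last exact: vle_supl.
apply/vle_supP; split; first exact: vle_refl.
by apply: (vle_trans 0) => //; rewrite -oppr0; exact: vleN2.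
Qed.

Lemma vpos_ge0 x : 0 <=v vsup x 0. Proof. exact: vle_supr. Qed.

Lemma vpos_sub_ge0 x : 0 <=v vsup x 0 - x.
Proof. by apply: vsubr_ge0; exact: vle_supl. Qed.

Lemma vle_norm_pos x y : 0 <=v x -> x <=v y -> `|x| <= `|y|.
Proof.
move=> x0 xy; apply: vle_norm; rewrite -/(vabs x) -/(vabs y) !vabs_id//.
exact: (vle_trans x).
Qed.

Lemma norm_vabs x : `|vabs x| = `|x|.
Proof.
apply/le_anti/andP; split; apply: vle_norm; rewrite -!/(vabs _);
  rewrite (vabs_id (vabs_ge0 x)); exact: vle_refl.
Qed.

Lemma vpos_norm x : `|vsup x 0| <= `|x|.
Proof.
rewrite -(norm_vabs x); apply: vle_norm_pos; first exact: vpos_ge0.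
by apply/vle_supP; split; [exact: vle_supl|exact: vabs_ge0].
Qed.

End vector_lattice.

(* The order of the dual is f <= g iff f x <= g x for all x >= 0, and its
   suprema are given on the positive cone by the Riesz-Kantorovich formula
   (f \/ g) x = sup {f y + g (x - y) | 0 <= y <= x}. *)
Section dual_lattice.
Context {R : realType} {E : banachLatticeType R}.
Implicit Types (f g h : dual_space E) (x y z : E).

Definition dual_le f g := forall x, 0 <=v x -> f x <= g x.

Definition riesz_kantorovich f g x : R :=
  sup [set f y + g (x - y) | y in [set y | 0 <=v y /\ y <=v x]].

Definition cone_extension (k : E -> R) x : R := k (vsup x 0) - k (vsup x 0 - x).

Lemma cone_extensionE (k : E -> R) :
  (forall x y, 0 <=v x -> 0 <=v y -> k (x + y) = k x + k y) ->
  forall x y, 0 <=v x -> 0 <=v y -> cone_extension k (x - y) = k x - k y.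
Proof.
move=> kD x y x0 y0; rewrite /cone_extension; set p := vsup _ 0.
have p0 : 0 <=v p by exact: vpos_ge0.
have q0 : 0 <=v p - (x - y) by exact: vpos_sub_ge0.
apply/eqP; rewrite subr_eq addrAC eq_sym subr_eq -!kD//.
by rewrite opprB addrCA subrKC.
Qed.

Lemma cone_extension_linear (k : E -> R) :
  (forall x y, 0 <=v x -> 0 <=v y -> k (x + y) = k x + k y) ->
  (forall a x, 0 <= a -> 0 <=v x -> k (a *: x) = a * k x) ->
  linear (cone_extension k).
Proof.
move=> kD kZ.
have ge0D x y : 0 <=v x -> 0 <=v y -> 0 <=v x + y.
  by move=> x0 y0; rewrite -(addr0 0); exact: vleD.
have ge0Z (a : R) x : 0 <= a -> 0 <=v x -> 0 <=v a *: x.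
  by move=> a0 x0; rewrite -(scaler0 E a); exact: vleZ2l.
have pE x : x = vsup x 0 - (vsup x 0 - x) by rewrite subKr.
have p0 x : 0 <=v vsup x 0 by exact: vpos_ge0.
have q0 x : 0 <=v vsup x 0 - x by exact: vpos_sub_ge0.
have eD x y : cone_extension k (x + y) = cone_extension k x + cone_extension k y.
  rewrite {1}(pE x) {1}(pE y) addrACA -opprD cone_extensionE//; try exact: ge0D.
  by rewrite (kD _ _ (p0 x) (p0 y)) (kD _ _ (q0 x) (q0 y)) opprD addrACA.
have eZ a x : 0 <= a -> cone_extension k (a *: x) = a * cone_extension k x.
  move=> a0; rewrite {1}(pE x) scalerBr cone_extensionE//; try exact: ge0Z.
  by rewrite !kZ// -mulrBr.
have eN x : cone_extension k (- x) = - cone_extension k x.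
  apply/eqP; rewrite -addr_eq0 -eD addNr -[X in cone_extension k X](scale0r 0).
  by rewrite eZ// mul0r.
move=> a x y; rewrite eD; congr (_ + _).
have [a0|/ltW a0] := leP 0 a; first exact: eZ.
by rewrite -[a]opprK scaleNr eN eZ ?oppr_ge0// -mulNr.
Qed.

Lemma riesz_kantorovich_has_sup f g x : 0 <=v x ->
  has_sup [set f y + g (x - y) | y in [set y | 0 <=v y /\ y <=v x]].
Proof.
move=> x0; split; first by exists (f x + g (x - x)), x => //=; split => //;
  exact: vle_refl.
exists (dual_norm f * `|x| + dual_norm g * `|x|) => _ [y [y0 yx] <-].
apply: lerD.
  rewrite (le_trans (ler_norm _))// (le_trans (dual_norm_ub _ _))//.
  by rewrite ler_wpM2l ?dual_norm_ge0//; exact: vle_norm_pos.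
rewrite (le_trans (ler_norm _))// (le_trans (dual_norm_ub _ _))//.
rewrite ler_wpM2l ?dual_norm_ge0//; apply: vle_norm_pos.
  exact: vsubr_ge0.
by apply: vle_subr; rewrite opprB addrC subrK.
Qed.

Lemma riesz_kantorovich_ub f g x y : 0 <=v y -> y <=v x ->
  f y + g (x - y) <= riesz_kantorovich f g x.
Proof.
move=> y0 yx; apply: (sup_upper_bound (riesz_kantorovich_has_sup f g _)).
  exact: (vle_trans y).
by exists y.
Qed.

Lemma riesz_kantorovich_le f g x (M : R) : 0 <=v x ->
  (forall y, 0 <=v y -> y <=v x -> f y + g (x - y) <= M) ->
  riesz_kantorovich f g x <= M.
Proof.
move=> x0 H; apply: ge_sup; first by have [] := riesz_kantorovich_has_sup f g x0.
by move=> _ [y [y0 yx] <-]; exact: H.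
Qed.

Lemma riesz_kantorovichD f g x x' : 0 <=v x -> 0 <=v x' ->
  riesz_kantorovich f g (x + x') =
  riesz_kantorovich f g x + riesz_kantorovich f g x'.
Proof.
move=> x0 x'0.
have xx'0 : 0 <=v x + x' by rewrite -(addr0 0); exact: vleD.
apply/le_anti/andP; split.
  apply: riesz_kantorovich_le => // z z0 zx.
  pose y := vinf z x.
  have -> : f z + g (x + x' - z) =
      (f y + g (x - y)) + (f (z - y) + g (x' - (z - y))).
    by rewrite !(linearB, linearD) /=; ring.
  apply: lerD; apply: riesz_kantorovich_ub.
  - exact/vle_infP.
  - exact: vle_infr.
  - by apply: vsubr_ge0; exact: vle_infl.
  - have : z - x' <=v y.
      apply/vle_infP; split; apply: vle_subr; first by rewrite subKr.
      by rewrite opprB addrA; exact: vsubr_ge0.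
    by move=> /vsubr_ge0 H; apply: vle_subr; move: H; rewrite !opprB addrCA.
rewrite -lerBrDr; apply: riesz_kantorovich_le => // y y0 yx.
rewrite lerBrDr -lerBrDl; apply: riesz_kantorovich_le => // y' y'0 yx'.
rewrite lerBrDl.
have -> : f y + g (x - y) + (f y' + g (x' - y')) =
    f (y + y') + g (x + x' - (y + y')).
  by rewrite !(linearB, linearD) /=; ring.
apply: riesz_kantorovich_ub; last exact: vleD.
by rewrite -(addr0 0); exact: vleD.
Qed.

Lemma riesz_kantorovichZ f g (a : R) x : 0 <= a -> 0 <=v x ->
  riesz_kantorovich f g (a *: x) = a * riesz_kantorovich f g x.
Proof.
have ge0Z (b : R) z : 0 <= b -> 0 <=v z -> 0 <=v b *: z.
  by move=> b0 z0; rewrite -(scaler0 E b); exact: vleZ2l.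
have le (b : R) z : 0 < b -> 0 <=v z ->
    riesz_kantorovich f g (b *: z) <= b * riesz_kantorovich f g z.
  move=> b0 z0; apply: riesz_kantorovich_le; first exact/ge0Z/z0/ltW.
  have bV0 : 0 <= b^-1 by rewrite invr_ge0 ltW.
  move=> y y0 yz; rewrite -ler_pdivrMl// mulrDr.
  rewrite -[_ * f y]linearZ -[_ * g _]linearZ /= scalerBr scalerK ?gt_eqF//.
  apply: riesz_kantorovich_ub; first exact: ge0Z.
  by rewrite -[X in _ <=v X](scalerK (lt0r_neq0 b0)); exact: vleZ2l.
rewrite le_eqVlt => /predU1P[<- x0|a0 x0].
  rewrite scale0r mul0r; apply/le_anti/andP; split.
    apply: riesz_kantorovich_le => [|y y0 y0']; first exact: vle_refl.
    by rewrite (vle_anti y0' y0) subr0 !linear0 addr0.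
  have := @riesz_kantorovich_ub f g 0 0 (vle_refl _) (vle_refl _).
  by rewrite subr0 !linear0 addr0.
apply/le_anti/andP; split; first exact: le.
rewrite -ler_pdivlMl// -{1}[x](scalerK (lt0r_neq0 a0)) le ?invr_gt0//.
by apply: ge0Z => //; exact: ltW.
Qed.

Lemma dual_sup_subproof f g :
  cone_extension (riesz_kantorovich f g) \in @functional_pred R E.
Proof.
have kl := cone_extension_linear (@riesz_kantorovichD f g)
  (@riesz_kantorovichZ f g).
rewrite inE; split => //.
set k := cone_extension _ in kl *.
pose K : {linear E -> R} := HB.pack k (GRing.isLinear.Build _ _ _ _ k kl).
apply: (@bounded_linear_continuous _ _ _ K); apply/linear_boundedP.
set M := dual_norm f + dual_norm g.
have rkM z : 0 <=v z -> `|riesz_kantorovich f g z| <= M * `|z|.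
  move=> z0; rewrite ler_norml; apply/andP; split.
    apply: le_trans (riesz_kantorovich_ub f g z0 (vle_refl z)).
    rewrite subrr linear0 addr0 lerNl (le_trans (ler_norm _))// normrN.
    rewrite (le_trans (dual_norm_ub _ _))// ler_wpM2r//.
    by rewrite lerDl dual_norm_ge0.
  apply: riesz_kantorovich_le => // y y0 yz; rewrite mulrDl lerD//.
    rewrite (le_trans (ler_norm _))// (le_trans (dual_norm_ub _ _))//.
    by rewrite ler_wpM2l ?dual_norm_ge0//; exact: vle_norm_pos.
  rewrite (le_trans (ler_norm _))// (le_trans (dual_norm_ub _ _))//.
  rewrite ler_wpM2l ?dual_norm_ge0//; apply: vle_norm_pos.
    exact: vsubr_ge0.
  by apply: vle_subr; rewrite opprB addrC subrK.
have M0 : 0 <= M by rewrite addr_ge0 ?dual_norm_ge0.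
near=> r => x; apply: (@le_trans _ _ (M * 3 * `|x|)); last by rewrite ler_wpM2r.
rewrite /= /k /cone_extension (le_trans (ler_normB _ _))//.
rewrite (le_trans (lerD (rkM _ (vpos_ge0 x)) (rkM _ (vpos_sub_ge0 x))))//.
rewrite -mulrDr -mulrA ler_wpM2l//.
have := ler_normB (vsup x 0) x; have := vpos_norm x; lra.
Unshelve. all: by end_near. Qed.

Definition dual_sup f g : dual_space E := Functional (dual_sup_subproof f g).

Definition dual_inf f g : dual_space E := - dual_sup (- f) (- g).

Lemma dual_supE f g x : 0 <=v x -> dual_sup f g x = riesz_kantorovich f g x.
Proof.
move=> x0; rewrite -[X in dual_sup _ _ X](subr0 x).
have -> : dual_sup f g (x - 0) =
    riesz_kantorovich f g x - riesz_kantorovich f g 0.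
  by apply: cone_extensionE => //; [exact: riesz_kantorovichD|exact: vle_refl].
rewrite -(scale0r (0 : E)) riesz_kantorovichZ//; last exact: vle_refl.
by rewrite mul0r subr0.
Qed.

Lemma dual_le_refl f : dual_le f f.
Proof. by []. Qed.

Lemma dual_le_anti f g : dual_le f g -> dual_le g f -> f = g.
Proof.
move=> fg gf; apply/val_inj/funext => x /=.
have fgE z : 0 <=v z -> f z = g z.
  by move=> z0; apply/le_anti; rewrite fg// gf.
rewrite -(subKr (vsup x 0) x) [LHS]linearB [RHS]linearB /= !fgE//.
  exact: vpos_sub_ge0.
exact: vpos_ge0.
Qed.

Lemma dual_le_trans g f h : dual_le f g -> dual_le g h -> dual_le f h.
Proof. by move=> fg gh x x0; apply: (le_trans (fg _ x0)); exact: gh. Qed.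

Lemma dual_le_supP f g h :
  dual_le (dual_sup f g) h <-> dual_le f h /\ dual_le g h.
Proof.
split=> [H|[fh gh] x x0].
  split=> x x0; apply: le_trans (H x x0); rewrite dual_supE//.
    have := riesz_kantorovich_ub f g x0 (vle_refl x).
    by rewrite subrr linear0 addr0.
  have := riesz_kantorovich_ub f g (vle_refl 0) x0.
  by rewrite linear0 add0r subr0.
rewrite dual_supE//; apply: riesz_kantorovich_le => // y y0 yx.
rewrite -[X in _ <= h X](subrKC y) [X in _ <= X]linearD lerD//; first exact: fh.
exact/gh/vsubr_ge0.
Qed.

Lemma dual_leN2 f g : dual_le f g -> dual_le (- g) (- f).
Proof. by move=> fg x x0; rewrite lerN2 fg. Qed.

Lemma dual_le_infP f g h :
  dual_le h (dual_inf f g) <-> dual_le h f /\ dual_le h g.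
Proof.
split=> [/dual_leN2|[hf hg]].
  rewrite opprK => /dual_le_supP[/dual_leN2 hf /dual_leN2 hg].
  by move: hf hg; rewrite !opprK.
rewrite -[h]opprK; apply: dual_leN2; apply/dual_le_supP.
by split; exact: dual_leN2.
Qed.

Lemma dual_leD2l h f g : dual_le f g -> dual_le (h + f) (h + g).
Proof. by move=> fg x x0; rewrite lerD2l fg. Qed.

Lemma dual_leZ2l (a : R) f g : 0 <= a -> dual_le f g -> dual_le (a *: f) (a *: g).
Proof. by move=> a0 fg x x0; rewrite ler_wpM2l// fg. Qed.

Lemma dual_le_norm f g :
  dual_le (dual_sup f (- f)) (dual_sup g (- g)) -> dual_norm f <= dual_norm g.
Proof.
move=> fg; apply: dual_norm_le => x x1.
have abs0 := vabs_ge0 x.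
have le_abs z : vabs z = vabs x -> f z <= dual_sup f (- f) (vabs x).
  move=> zx; rewrite dual_supE//.
  pose y := 2^-1 *: (vabs x + z).
  have h0 : 0 <= 2^-1 :> R by rewrite invr_ge0.
  have hD t : 2^-1 *: t + 2^-1 *: t = t :> E.
    by rewrite -scalerDl -div1r -splitr scale1r.
  have yE : vabs x - y = 2^-1 *: (vabs x - z).
    by rewrite -{1}(hD (vabs x)) /y scalerDr scalerBr opprD addrACA subrr add0r.
  have y0 : 0 <=v y.
    rewrite -(scaler0 E 2^-1); apply: vleZ2l => //.
    by rewrite addrC -[z]opprK addrC; apply: vsubr_ge0; rewrite -zx; exact: vle_supr.
  have yx : y <=v vabs x.
    apply: vle_subr; rewrite yE -(scaler0 E 2^-1); apply: vleZ2l => //.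
    by apply: vsubr_ge0; rewrite -zx; exact: vle_supl.
  apply: le_trans (riesz_kantorovich_ub f (- f) y0 yx).
  rewrite -[X in _ + X]/(- f (vabs x - y)) -[X in _ <= X]linearB /=.
  rewrite yE /y -scalerBr opprB addrC addrA subrK.
  by rewrite scalerDr hD.
have nabs : vabs (- x) = vabs x.
  by rewrite /vabs opprK; apply: vle_anti; apply/vle_supP; split;
    solve [exact: vle_supl|exact: vle_supr].
have fx : `|f x| <= dual_sup f (- f) (vabs x).
  by rewrite ler_norml lerNl -linearN !le_abs.
apply: (le_trans fx); apply: (le_trans (fg _ abs0)); rewrite dual_supE//.
apply: riesz_kantorovich_le => // y y0 yx.
rewrite -[X in _ + X]/(- g (vabs x - y)) -linearB /=.
rewrite (le_trans (ler_norm _))// (le_trans (dual_norm_ub _ _))//.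
rewrite ler_piMr ?dual_norm_ge0// (le_trans _ x1)// -(norm_vabs x).
have ge0D z t : 0 <=v z -> 0 <=v t -> 0 <=v z + t.
  by move=> z0 t0; rewrite -(addr0 0); exact: vleD.
apply: vle_norm; rewrite -!/(vabs _) [X in _ <=v X]vabs_id//.
have yx' := vsubr_ge0 yx.
apply/vle_supP; split; apply: vle_subr.
  by rewrite opprB addrCA; exact: ge0D.
by rewrite !opprB addrCA subrKC; exact: ge0D.
Qed.

HB.instance Definition _ := isBanachLattice.Build R (dual_space E)
  dual_le_refl dual_le_anti dual_le_trans dual_le_supP dual_le_infP
  dual_leD2l dual_leZ2l dual_le_norm.

Lemma dual_leE f g : (f <=v g) = (forall x, 0 <=v x -> f x <= g x).
Proof. by []. Qed.

End dual_lattice.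

Section banach_lattice_notions.
Context {R : realType} {E : banachLatticeType R}.

Definition vdisjoint (x y : E) : Prop := vinf (vabs x) (vabs y) = 0.

Definition disjoint_sequence (x : nat -> E) : Prop :=
  forall m n, m <> n -> vdisjoint (x m) (x n).

Definition order_interval (a b : E) : set E := [set x | a <=v x /\ x <=v b].

Definition order_bounded (A : set E) : Prop :=
  exists a b, A `<=` order_interval a b.

End banach_lattice_notions.

(* Every net x decreasing to 0, i.e. decreasing with infimum 0, converges to 0
   in norm; the nets are indexed by an arbitrary directed preorder (I, r). *)
Definition order_continuous_norm {R : realType} (E : banachLatticeType R) : Prop :=
  forall (I : Type) (r : I -> I -> Prop) (x : I -> E),
    inhabited I ->
    (forall i, r i i) ->
    (forall i j k, r i j -> r j k -> r i k) ->
    (forall i j, exists k, r i k /\ r j k) ->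
    (forall i j, r i j -> x j <=v x i) ->
    (forall i, 0 <=v x i) ->
    (forall z, (forall i, z <=v x i) -> z <=v 0) ->
  forall e : R, 0 < e -> exists i0, forall i, r i0 i -> `|x i| < e.

Definition weak_star_null {R : realType} {X : normedModType R}
    (f : nat -> dual_space X) : Prop :=
  forall x : X, f n x @[n --> \oo] --> (0 : R).

Definition limited {R : realType} {X : completeNormedModType R} (C : set X) : Prop :=
  bounded_set C /\
  forall f : nat -> dual_space X, weak_star_null f ->
    {uniform C, (fun n => f n : X -> R) @ \oo --> (fun=> 0 : R)}.

Definition almost_limited {R : realType} {F : banachLatticeType R} (A : set F) : Prop :=
  bounded_set A /\
  forall f : nat -> dual_space F, disjoint_sequence f -> weak_star_null f ->
    {uniform A, (fun n => f n : F -> R) @ \oo --> (fun=> 0 : R)}.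

Section operators.
Context {R : realType} {E F : banachLatticeType R}.
Implicit Types T S : {linear E -> F}.

Definition positive_operator T : Prop := forall x, 0 <=v x -> 0 <=v T x.

Definition regular_operator T : Prop :=
  exists S1 S2 : {linear E -> F},
    [/\ positive_operator S1, positive_operator S2 & forall x, T x = S1 x - S2 x].

Definition bounded_operator T : Prop :=
  exists M : R, forall x, `|T x| <= M * `|x|.

Definition almost_limited_operator T : Prop :=
  bounded_operator T /\ almost_limited (T @` [set x | `|x| <= 1]).

End operators.

(* Main.v *)
Require Import Defs.
From HB Require Import structures.
From mathcomp Require Import all_boot all_order all_algebra.
From mathcomp Require Import all_classical all_reals all_analysis.
From mathcomp Require Import lra.

Import Order.TTheory GRing.Theory Num.Theory.
Import numFieldNormedType.Exports.
Local Open Scope classical_set_scope.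
Local Open Scope ring_scope.
Local Open Scope lattice_scope.

(** Write T = S1 - S2 with S1, S2 >= 0 and let f be w*-null in F*. As order
    intervals of F are limited, the Riesz-Kantorovich formula gives
    |f_n|(y) -> 0 for all y >= 0, so the positive functionals
    g_n := |f_n| o (S1 + S2), which dominate |f_n o T|, tend to 0 pointwise on
    the positive cone of E. If they did not do so uniformly on the positive part
    of the ball, there would be x_k >= 0 in the ball with g_{n_k}(x_k) > e, and
    n_k could be chosen so large that g_{n_k} is small on multiples of the earlier
    x_i. Subtracting these multiples and a small multiple of a common majorant
    turns (x_k) into a disjoint sequence (u_k) with g_{n_k}(u_k) > e / 2
    eventually. But (u_k) is order bounded, so g_{n_k}(u_k) -> 0. *)

(** * Positive cones, geometric majorants and disjointification *)

Section cone.
Context {R : realType} {E : banachLatticeType R}.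
Implicit Types x y z : E.

Lemma vaddr_ge0 x y : 0 <=v x -> 0 <=v y -> 0 <=v x + y.
Proof. by move=> x0 y0; rewrite -(addr0 0); exact: vleD. Qed.

Lemma vscale_ge0 (a : R) x : 0 <= a -> 0 <=v x -> 0 <=v a *: x.
Proof. by move=> a0 x0; rewrite -(scaler0 E a); exact: vleZ2l. Qed.

Lemma vpos_mono x y : x <=v y -> vsup x 0 <=v vsup y 0.
Proof.
move=> xy; apply/vle_supP; split; last exact: vle_supr.
exact: vle_trans xy (vle_supl _ _).
Qed.

Lemma vposZ_le (a : R) x : 0 <= a -> a *: vsup x 0 <=v vsup (a *: x) 0.
Proof.
rewrite le_eqVlt => /predU1P[<-|a0]; first by rewrite scale0r; exact: vle_supr.
rewrite -[X in _ <=v X](scalerKV (lt0r_neq0 a0)).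
apply: vleZ2l; first exact: ltW.
have aV0 : 0 <= a^-1 by rewrite invr_ge0 ltW.
apply/vle_supP; split; last exact: (vscale_ge0 _ _ aV0 (vle_supr _ _)).
rewrite -{1}[x](scalerK (lt0r_neq0 a0)); apply: vleZ2l => //.
exact: vle_supl.
Qed.

(** This is x^+ /\ x^- = 0. As x^- = x^+ - x, the two bounds on [z] give 0 <= x^+ - z and x <= x^+ -
    z, hence x^+ <= x^+ - z. *)
Lemma vpos_neg_le0 x z : z <=v vsup x 0 -> z <=v vsup (- x) 0 -> z <=v 0.
Proof.
move=> zx zNx.
have zxx : z <=v vsup x 0 - x.
  apply: (vle_trans _ zNx); apply/vle_supP; split; last exact: vpos_sub_ge0.
  by apply: vle_subr; rewrite opprK subrK; exact: vle_supr.
have : vsup x 0 <=v vsup x 0 - z.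
  apply/vle_supP; split; last exact: vsubr_ge0.
  by have := vleD2l (x - z) zxx; rewrite subrK addrC subrKA.
by move=> /(vleD2l (- vsup x 0)); rewrite addNr addKr => /vleN2;
  rewrite opprK oppr0.
Qed.

(** Since -l <= x_n - l, the norm of (-l)^+ is at most that of x_n - l, which tends to 0. *)
Lemma vnonneg_closed (x : nat -> E) (l : E) :
  (forall n, 0 <=v x n) -> x n @[n --> \oo] --> l -> 0 <=v l.
Proof.
move=> x0 xl.
have : vsup (- l) 0 = 0.
  apply/eqP; rewrite -normr_le0; apply/ler_addgt0Pr => e e0; rewrite add0r.
  move/cvgrPdist_le: xl => /(_ e e0)[N _ /(_ N (leqnn _))].
  apply: le_trans; rewrite distrC.
  apply: le_trans (vpos_norm _); apply: vle_norm_pos; first exact: vpos_ge0.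
  apply: vpos_mono; apply: vle_subr; rewrite opprK subrK.
  exact: x0.
move=> l0; have := vle_supl (- l) 0; rewrite l0 => /vleN2.
by rewrite opprK oppr0.
Qed.

(** Take for [w] the sum of the series of 2^-n x_n, which converges absolutely. Its terms are
    positive and the cone is closed, so each term lies below the sum. *)
Lemma geometric_majorant (x : nat -> E) :
  (forall n, 0 <=v x n) -> (forall n, `|x n| <= 1) ->
  exists2 w, 0 <=v w & forall n, x n <=v 2 ^+ n *: w.
Proof.
move=> x0 x1.
pose u n := (2^-1) ^+ n *: x n : E.
have u0 n : 0 <=v u n by apply: vscale_ge0 => //; rewrite exprn_ge0// invr_ge0.
have cu : cvgn (series u).
  apply: normed_cvg.
  apply: (@series_le_cvg R _ (geometric 1 2^-1)).
  - by move=> n; exact: normr_ge0.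
  - by move=> n /=; rewrite mul1r exprn_ge0// invr_ge0.
  - move=> n /=; rewrite mul1r normrZ normrX ger0_norm ?invr_ge0//.
    by rewrite ler_piMr// exprn_ge0// invr_ge0.
  - by apply: is_cvg_geometric_series; rewrite ger0_norm ?invr_ge0//; lra.
have sum0 m n : 0 <=v \sum_(m <= i < n) u i.
  by apply: big_ind => //; [exact: vle_refl|exact: vaddr_ge0].
exists (limn (series u)); first by apply: (vnonneg_closed (series u)) => // n; exact: sum0.
move=> n.
suff un : u n <=v limn (series u).
  rewrite -[x n](@scalerK _ _ (2^-1 ^+ n)) ?expf_neq0 ?invr_eq0//.
  by rewrite -exprVn invrK; apply: vleZ2l => //; rewrite exprn_ge0.
apply: vle_subr.
(* The shift by n + 1 makes every partial sum contain the term [u n]. *)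
apply: (vnonneg_closed (fun m => series u (m + n.+1)%N - u n)).
  move=> m; rewrite /series/= (@big_cat_nat _ _ _ n)//= ?(leq_trans _ (leq_addl _ _))//.
  rewrite (big_ltn (m := n)) ?leq_addl// addrCA addrAC subrr add0r.
  exact: vaddr_ge0.
by apply: cvgB; [rewrite (cvg_shiftn n.+1)|exact: cvg_cst].
Qed.

(* Aliprantis-Burkinshaw's disjointification: for [m < n], up to a scalar,
   [u n] lies below [(2^-m w - x m)^+] and [u m] below its opposite
   [(x m - 2^-m w)^+]. *)
Lemma disjointification (x s : nat -> E) (w : E) :
  (forall n, 0 <=v x n) -> (forall n, 0 <=v s n) -> 0 <=v w ->
  (forall m n, (m < n)%N -> x m <=v s n) ->
  (forall n, x n <=v 2 ^+ n *: w) ->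
  disjoint_sequence
    (fun n => vsup (x n - 4 ^+ n *: s n - 2^-1 ^+ n *: w) 0).
Proof.
move=> x0 s0 w0 xs xw.
set u := fun n => _.
have u0 n : 0 <=v u n by exact: vle_supr.
suff main m n z : (m < n)%N -> z <=v u m -> z <=v u n -> z <=v 0.
  move=> m n /eqP; rewrite /vdisjoint !vabs_id// neq_ltn => mn.
  apply: vle_anti; last exact/vle_infP.
  by case/orP: mn => mn; apply: (main _ _ _ mn);
    solve [exact: vle_infl|exact: vle_infr].
move=> mn zm zn.
have zu : z <=v vsup (x m - 2^-1 ^+ m *: w) 0.
  apply: (vle_trans _ zm); apply: vpos_mono.
  rewrite addrAC -[X in _ <=v X]addr0; apply: vleD2l.
  by rewrite -oppr0; apply: vleN2; apply: vscale_ge0 => //; rewrite exprn_ge0.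
(* Scaling by 4^-n turns 4^n s_n into s_n >= x_m, and the bound 2^n w on x_n into 2^-n w <= 2^-m
   w. *)
pose c : R := 4^-1 ^+ n.
have c0 : 0 < c by rewrite exprn_gt0// invr_gt0.
have c1 : c <= 1 by rewrite exprn_ile1// ?invr_ge0// invf_le1 ?ler1n.
have cw : c *: (x n - 4 ^+ n *: s n - 2^-1 ^+ n *: w) <=v
    - (x m - 2^-1 ^+ m *: w).
  rewrite !scalerBr scalerA -exprMn mulVf// expr1n scale1r opprB.
  rewrite -[X in _ <=v X]addr0; apply: vleD; last first.
    by rewrite -oppr0; apply: vleN2; apply: vscale_ge0; [exact: ltW|];
      apply: vscale_ge0 => //; rewrite exprn_ge0// invr_ge0.
  apply: vleD; last exact/vleN2/xs.
  apply: (vle_trans _ (vleZ2l (ltW c0) (xw n))).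
  rewrite scalerA /c -exprMn.
  have -> : 4^-1 * 2 = 2^-1 :> R by lra.
  apply: vle_subr; rewrite -scalerBl; apply: vscale_ge0 => //.
  by rewrite subr_ge0 ler_wiXn2l ?invr_ge0 ?invf_le1 ?ler1n// ltnW.
suff : c *: z <=v 0.
  move=> /(vleZ2l (ltW (_ : 0 < c^-1))); rewrite invr_gt0 => /(_ c0).
  by rewrite scaler0 scalerK// gt_eqF.
apply: (vpos_neg_le0 (x m - 2^-1 ^+ m *: w)).
  apply: (vle_trans _ (vleZ2l (ltW c0) zu)).
  rewrite -[X in _ <=v X]scale1r; apply: vle_subr; rewrite -scalerBl.
  by apply: vscale_ge0; [rewrite subr_ge0|exact: vle_supr].
apply: (vle_trans _ (vleZ2l (ltW c0) zn)).
apply: vle_trans (vposZ_le _ _ (ltW c0)) _.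
exact: vpos_mono.
Qed.

End cone.

(** * Uniform convergence on the positive part of the ball *)

Lemma uniform_nullP {R : realType} {X : choiceType} (A : set X)
    (f : nat -> X -> R) :
  {uniform A, f @ \oo --> (fun=> 0 : R)} <->
  forall e : R, 0 < e -> \forall n \near \oo, forall x, A x -> `|f n x| <= e.
Proof.
split=> [fA e e0|fA P /uniform_nbhs[D []]].
  apply: (fA [set h | forall x, A x -> `|h x| <= e]); apply/uniform_nbhs.
  exists [set p | `|p.1 - p.2| < e]; split.
    by rewrite -entourage_ballE; exists e => //= -[a b]; rewrite /ball/=.
  by move=> h /= hA x /hA; rewrite sub0r normrN => /ltW.
rewrite -entourage_ballE => -[e /= e0 De] DP.
have e20 : 0 < e / 2 by rewrite divr_gt0.
apply: filterS (fA _ e20) => n fn; apply: DP => x Ax; apply: De => /=.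
rewrite /ball/= sub0r normrN (le_lt_trans (fn x Ax))//; lra.
Qed.

Lemma uniform_null_on_ball {R : realType} {E : banachLatticeType R}
    (g : nat -> {linear E -> R}) :
  (forall x : nat -> E,
    disjoint_sequence x -> bounded_set (range x) -> order_bounded (range x)) ->
  (forall n x, 0 <=v x -> 0 <= g n x) ->
  (forall x, 0 <=v x -> g n x @[n --> \oo] --> (0 : R)) ->
  forall e : R, 0 < e ->
    \forall n \near \oo, forall x, 0 <=v x -> `|x| <= 1 -> g n x <= e.
Proof.
move=> bndE g0 gcv e e0; apply/not_notP => nfar.
have gmono n x y : x <=v y -> g n x <= g n y.
  by move=> /vsubr_ge0/(g0 n); rewrite linearB subr_ge0.
have gsmall x d : 0 <=v x -> 0 < d ->
    exists N, forall n, (N <= n)%N -> g n x <= d.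
  move=> x0 d0; move/cvgrPdist_le: (gcv x x0) => /(_ d d0)[N _ HN].
  exists N => n /HN/=; rewrite sub0r normrN => /(le_trans _); apply.
  exact: ler_norm.
have far N : exists n x, [/\ (N <= n)%N, 0 <=v x, `|x| <= 1 & e < g n x].
  apply/not_notP => H; apply: nfar; exists N => //= n Nn x x0 x1.
  by rewrite leNgt; apply/negP => ex; apply: H; exists n, x.
(* The state [p] is (k, s_k), with s_k the sum of the vectors chosen before stage k; [step] returns
   (n_k, x_k). Off the positive cone its value is arbitrary. *)
have /choice[step stepP] (p : nat * E) : exists q : nat * E, 0 <=v p.2 ->
    [/\ (p.1 <= q.1)%N, 0 <=v q.2, `|q.2| <= 1, e < g q.1 q.2 &
        g q.1 (4 ^+ p.1 *: p.2) <= e / 4].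
  have [p0|np0] := pselect (0 <=v p.2); last by exists p.
  have e40 : 0 < e / 4 by rewrite divr_gt0.
  have p40 : 0 <=v (4 : R) ^+ p.1 *: p.2 by apply: vscale_ge0; rewrite ?exprn_ge0.
  have [N HN] := gsmall _ _ p40 e40.
  have [n [x [nN x0 x1 ex]]] := far (maxn N p.1).
  move: nN; rewrite geq_max => /andP[Nn pn].
  by exists (n, x) => _; split => //; exact: HN.
pose s := fix s k := if k is k'.+1 then s k' + (step (k', s k')).2 else 0 : E.
pose x k := (step (k, s k)).2; pose m k := (step (k, s k)).1.
have s0 k : 0 <=v s k.
  elim: k => [|k IH]; first exact: vle_refl.
  by apply: vaddr_ge0 => //; have [] := stepP (k, s k) IH.
have xP k : [/\ (k <= m k)%N, 0 <=v x k, `|x k| <= 1, e < g (m k) (x k) &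
    g (m k) (4 ^+ k *: s k) <= e / 4] by exact: (stepP (k, s k) (s0 k)).
have x0 k : 0 <=v x k by have [] := xP k.
have x1 k : `|x k| <= 1 by have [] := xP k.
have xs i k : (i < k)%N -> x i <=v s k.
  elim: k => // k IH; rewrite ltnS leq_eqVlt => /predU1P[->|/IH ik].
    by rewrite -[X in X <=v _]add0r; apply: vleD => //; exact: vle_refl.
  by rewrite -[X in X <=v _]addr0; apply: vleD => //; exact: x0.
have [w w0 xw] := geometric_majorant x x0 x1.
have := disjointification x s w x0 s0 w0 xs xw.
set u := fun n => _ => du.
have u0 k : 0 <=v u k by exact: vle_supr.
have ux k : u k <=v x k.
  apply/vle_supP; split; last exact: x0.
  rewrite -addrA -[X in _ <=v X]addr0; apply: vleD2l.
  rewrite -opprD -oppr0; apply: vleN2; apply: vaddr_ge0; apply: vscale_ge0 => //.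
have bu : bounded_set (range u).
  exists 1; split => // M M1 _ [k _ <-].
  by apply: le_trans (ltW M1); apply: le_trans (x1 k); exact: vle_norm_pos.
have [a [b ub]] := bndE u du bu.
have ule k : u k <=v b by have [] := ub (u k) (ex_intro2 _ _ k I erefl).
have b0 : 0 <=v b := vle_trans _ (u0 0%N) (ule 0%N).
have e40 : 0 < e / 4 by rewrite divr_gt0.
have [N1 H1] := gsmall b _ b0 e40; have [N2 H2] := gsmall w _ w0 e40.
(* As n_k >= k, the functional [g (m k)] is at most e / 4 at both [b] and [w]. *)
pose k := maxn N1 N2.
have [km _ _ ex es] := xP k.
have gb : g (m k) b <= e / 4 by apply/H1/(leq_trans _ km)/leq_maxl.
have gw : g (m k) w <= e / 4 by apply/H2/(leq_trans _ km)/leq_maxr.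
have gw' : g (m k) (2^-1 ^+ k *: w) <= e / 4.
  apply: le_trans gw; rewrite linearZ /= ler_piMl ?g0// exprn_ile1//; lra.
(* Since x_k - 4^k s_k - 2^-k w <= u_k <= b, the value of [g (m k)] at x_k is at most a sum of three
   terms bounded by e / 4, yet it exceeds e. *)
have := gmono (m k) _ _ (vle_trans _ (vle_supl _ _) (ule k)).
rewrite !linearB /=; lra.
Qed.

(** * Norm bounds obtained from the positive cone *)

(** Split x = x^+ - x^-. The factor 3 is 1 + 2: the norm of x^+ is at most that of x, and the
    triangle inequality bounds the norm of x^- = x^+ - x by twice that of x. *)
Lemma linear_norm_le {R : realType} {E : banachLatticeType R}
    {V : normedModType R} (T : {linear E -> V}) (M : R) :
  (forall u, 0 <=v u -> `|u| <= 1 -> `|T u| <= M) ->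
  forall x, `|T x| <= 3 * M * `|x|.
Proof.
move=> TM.
have Tpos u : 0 <=v u -> `|T u| <= M * `|u|.
  move=> u0; have [->|nz] := eqVneq u 0; first by rewrite linear0 !normr0 mulr0.
  have nu : 0 < `|u| by rewrite normr_gt0.
  have nu0 : 0 <= `|u|^-1 by rewrite invr_ge0 ltW.
  have := TM (`|u|^-1 *: u) (vscale_ge0 _ _ nu0 u0).
  rewrite linearZ !normrZ (ger0_norm nu0) mulVf ?gt_eqF// => /(_ (lexx _)).
  by rewrite ler_pdivrMl// mulrC.
have M0 : 0 <= M by have := TM 0 (vle_refl _); rewrite linear0 !normr0; apply.
move=> x; rewrite -{1}(subKr (vsup x 0) x) linearB.
apply: le_trans (ler_normB _ _) _.
apply: le_trans (lerD (Tpos _ (vpos_ge0 x)) (Tpos _ (vpos_sub_ge0 x))) _.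
rewrite -mulrDr [3 * M]mulrC -mulrA ler_wpM2l//.
have := ler_normB (vsup x 0) x; have := vpos_norm x; lra.
Qed.

(** Otherwise there are u_k >= 0 in the ball with |T u_k| > k 2^k. A geometric majorant [w] gives |T
    u_k| <= 2^k |T w|, which is absurd once k >= |T w|. *)
Lemma positive_operator_bounded {R : realType} {E F : banachLatticeType R}
    (T : {linear E -> F}) :
  positive_operator T -> bounded_operator T.
Proof.
move=> T0; suff [M TM] : exists M : R, forall u, 0 <=v u -> `|u| <= 1 -> `|T u| <= M.
  by exists (3 * M); exact: linear_norm_le.
apply/not_notP => unb.
have /choice[u uP] (k : nat) : exists u : E,
    [/\ 0 <=v u, `|u| <= 1 & k%:R * 2 ^+ k < `|T u|].
  apply/not_notP => H; apply: unb; exists (k%:R * 2 ^+ k) => u u0 u1.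
  by rewrite leNgt; apply/negP => ku; apply: H; exists u.
have u0 k : 0 <=v u k by have [] := uP k.
have u1 k : `|u k| <= 1 by have [] := uP k.
have [w w0 uw] := geometric_majorant u u0 u1.
pose k := Num.bound `|T w|.
have [_ _] := uP k; apply/negP; rewrite -leNgt.
apply: (@le_trans _ _ `|T (2 ^+ k *: w)|).
  apply: vle_norm_pos; first exact: T0.
  by apply: vle_subr; rewrite -linearB; apply/T0/vsubr_ge0.
rewrite linearZ normrZ ger0_norm ?exprn_ge0// mulrC ler_wpM2r ?exprn_ge0//.
exact/ltW/archi_boundP.
Qed.

(** * Moduli of functionals, and the conclusion *)

Lemma dual_vabs_ge {R : realType} {F : banachLatticeType R} (f : dual_space F) y :
  0 <=v y -> `|f y| <= vabs f y.
Proof.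
move=> y0; rewrite ler_norml lerNl.
have := vle_supr f (- f) => /(_ y y0) => ->.
exact: (vle_supl f (- f) y y0).
Qed.

(** By the Riesz-Kantorovich formula, |f_n|(y) is the supremum of f_n(z - (y - z)) over 0 <= z <= y,
    and z - (y - z) stays in the limited interval [-y, y]. *)
Lemma limited_vabs_null {R : realType} {F : banachLatticeType R}
    (f : nat -> dual_space F) :
  (forall a b : F, limited (order_interval a b)) -> weak_star_null f ->
  forall y, 0 <=v y -> vabs (f n) y @[n --> \oo] --> (0 : R).
Proof.
move=> limF fw y y0; apply/cvgrPdist_le => e e0.
have [_ /(_ f fw)/uniform_nullP/(_ e e0)] := limF (- y) y.
apply: filterS => n fn; rewrite sub0r normrN ger0_norm; last first.
  exact: le_trans (dual_vabs_ge _ _ y0).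
rewrite [vabs (f n) y]dual_supE//; apply: riesz_kantorovich_le => // z z0 zy.
rewrite -[X in _ + X]/(- f n (y - z)) -linearB /=.
apply: le_trans (ler_norm _) (fn _ _); split; apply: vle_subr.
  by rewrite opprK addrAC opprB addrACA subrr addr0; exact: vaddr_ge0.
by rewrite opprB addrCA; apply: vaddr_ge0; exact: vsubr_ge0.
Qed.

Theorem theorem3p7 (R : realType) (E F : banachLatticeType R)
    (ocE' : order_continuous_norm (dual_space E))
    (ocF : order_continuous_norm F)
    (limF : forall a b : F, limited (order_interval a b))
    (bndE : forall x : nat -> E,
      disjoint_sequence x -> bounded_set (range x) -> order_bounded (range x))
    (T : {linear E -> F}) :
  regular_operator T -> almost_limited_operator T.
Proof.
move=> [S1 [S2 [S10 S20 TS]]].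
have [M TM] : bounded_operator T.
  have [M1 SM1] := positive_operator_bounded S1 S10.
  have [M2 SM2] := positive_operator_bounded S2 S20.
  exists (M1 + M2) => x; rewrite TS mulrDl.
  exact: le_trans (ler_normB _ _) (lerD _ _).
split; first by exists M.
split.
  exists `|M|; split => // r Mr _ [x /= x1 <-].
  apply: le_trans (ltW Mr); apply: le_trans (TM x) _.
  by apply: le_trans (ler_wpM2r _ (ler_norm M)) _ => //; rewrite ler_piMr.
move=> f _ fw; apply/uniform_nullP => e e0.
(* For u >= 0, |f_n(T u)| <= |f_n|(S1 u) + |f_n|(S2 u), which is [g n u]. *)
pose S : {linear E -> F} := S1 \+ S2.
pose g n : {linear E -> R} := vabs (f n) \o S.
have S0 x : 0 <=v x -> 0 <=v S x.
  by move=> x0; apply: vaddr_ge0; [exact: S10|exact: S20].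
(* The third compensates the factor 3 of [linear_norm_le], used to pass from the positive part of
   the ball to the whole ball. *)
have e30 : 0 < e / 3 by rewrite divr_gt0.
have g0 n x : 0 <=v x -> 0 <= g n x.
  by move=> /S0/(dual_vabs_ge (f n)); exact: le_trans.
have gcv x : 0 <=v x -> g n x @[n --> \oo] --> (0 : R).
  by move=> /S0; exact: limited_vabs_null.
apply: filterS (uniform_null_on_ball g bndE g0 gcv (e / 3) e30).
move=> n gn _ [x /= x1 <-].
pose fT : {linear E -> R} := f n \o T.
have fTu u : 0 <=v u -> `|u| <= 1 -> `|fT u| <= e / 3.
  move=> u0 u1; apply: le_trans (gn u u0 u1).
  rewrite -[fT u]/(f n (T u)) TS linearB.
  rewrite -[g n u]/(vabs (f n) (S1 u + S2 u)) linearD.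
  apply: le_trans (ler_normB _ _) (lerD _ _); apply: dual_vabs_ge.
    exact: S10.
  exact: S20.
apply: le_trans (linear_norm_le fT (e / 3) fTu x) _.
have -> : 3 * (e / 3) = e by lra.
by rewrite ler_piMr// ltW.
Qed.
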